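(* Let $P\subset\mathbb R^n$ be an $n$-dimensional strongly monotypic polytope and let $X=N(P)$ be its set of facet normals. Then $X$ contains some $k\ge 1$ pairwise disjoint subsets $X_1,\dots,X_k$ such that: (i) each $X_i$ is the vertex set of a simplex whose relative interior contains $0$; (ii) the linear spaces $\operatorname{span} X_1,\dots,\operatorname{span} X_k$ are linearly independent (i.e., their sum is direct); and (iii) $\operatorname{span} X_1\oplus\cdots\oplus\operatorname{span} X_k=\mathbb R^n$.
   Context: For a polytope $P$, $N(P)$ denotes the set of outer unit normal vectors of the facets of $P$. A polytope $P$ is called strongly monotypic if for every polytope $Q$ with $N(Q)=N(P)$, the arrangement of the hyperplanes containing the facets of $P$ and the arrangement of the hyperplanes containing the facets of $Q$ are combinatorially equivalent. *)

(* Defs.v *)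
From HB Require Import structures.
From mathcomp Require Import all_boot all_order all_algebra.
From mathcomp Require Import reals.
Set Implicit Arguments. Unset Strict Implicit. Unset Printing Implicit Defensive.
Import Order.TTheory GRing.Theory Num.Theory.
Local Open Scope ring_scope.

Section Defs.
Variables (R : realType) (n : nat).
Local Notation vec := 'rV[R]_n.

Definition dot (u x : vec) : R := (u *m x^T) 0 0.

Definition conv (s : seq vec) (x : vec) : Prop :=
  exists l : 'I_(size s) -> R,
    (forall i, 0 <= l i) /\ \sum_i l i = 1 /\ x = \sum_i l i *: s`_(val i).

Definition polytope (P : vec -> Prop) : Prop :=
  exists s : seq vec, forall x, P x <-> conv s x.

Definition affine_indep (s : seq vec) : Prop :=
  forall c : 'I_(size s) -> R,
    \sum_i c i = 0 -> \sum_i c i *: s`_(val i) = 0 -> forall i, c i = 0.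

(* dim A >= d - 1 : A contains d affinely independent points *)
Definition has_aff_indep (A : vec -> Prop) (d : nat) : Prop :=
  exists s : seq vec, size s = d /\ (forall x, x \in s -> A x) /\ affine_indep s.

Definition full_dim (P : vec -> Prop) : Prop := has_aff_indep P n.+1.

Definition face (P : vec -> Prop) (u : vec) (x : vec) : Prop :=
  P x /\ forall y, P y -> dot u y <= dot u x.

(* N(P) : outer unit normals of the facets ((n-1)-dimensional faces) of P *)
Definition normals (P : vec -> Prop) (u : vec) : Prop :=
  dot u u = 1 /\ has_aff_indep (face P u) n.

(* sign vectors of the arrangement of facet hyperplanes
   H_u(P) = { x | <u,x> = h_P(u) }, u in N(P):  sigma is realized by some
   point x, i.e. sigma u = sgn(<u,x> - h_P(u)) for all u in N(P). *)
Definition realized_sign_vector (P : vec -> Prop) (sigma : vec -> R) : Prop :=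
  exists x : vec, forall u, normals P u ->
    forall p, face P u p -> sigma u = Num.sg (dot u x - dot u p).

(* combinatorial equivalence of the two facet-hyperplane arrangements
   (hyperplanes matched via their common normal u) : same set of covectors *)
Definition arrangements_comb_equiv (P Q : vec -> Prop) : Prop :=
  forall sigma : vec -> R,
    realized_sign_vector P sigma <-> realized_sign_vector Q sigma.

Definition strongly_monotypic (P : vec -> Prop) : Prop :=
  forall Q : vec -> Prop, polytope Q -> full_dim Q ->
    (forall u, normals Q u <-> normals P u) ->
    arrangements_comb_equiv P Q.

Definition simplex_rel_int_0 (X : seq vec) : Prop :=
  affine_indep X /\
  exists l : 'I_(size X) -> R,
    (forall i, 0 < l i) /\ \sum_i l i = 1 /\ \sum_i l i *: X`_(val i) = 0.

End Defs.

(* Main.v *)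
(* Let U be a minimal set of facet normals whose positive hull is R^n.
   Strong monotypy forbids a minimal linear relation among facet normals with at
   least two positive and at least two negative coefficients: for such a relation
   the polytopes with normals N(P) and support numbers 1 + max(0, <w, v>) realize,
   for suitable v, incompatible sign patterns.
   Grow a family of positive circuits with independent spans, of sum L, inside U.
   If L <> R^n, Caratheodory's theorem modulo L yields Y in U, positively
   independent up to one relation modulo L, with r = sum_Y l_y y in L, and r is a
   positive combination of independent elements T of the circuits found so far.
   If r <> 0, then Y against T is a minimal relation with |Y| >= 2, so T = {t},
   and t lies in the positive hull of Y, hence of U \ {t}, contradicting the
   minimality of U. So r = 0 and Y is a new positive circuit. *)
Require Import Defs.
From HB Require Import structures.
From mathcomp Require Import all_boot all_order all_algebra.
From mathcomp Require Import boolp reals.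
From mathcomp Require Import ring lra zify.
Set Implicit Arguments. Unset Strict Implicit. Unset Printing Implicit Defensive.
Import Order.TTheory GRing.Theory Num.Theory.
Local Open Scope ring_scope.

(** * Dot product, free families and orthogonal vectors *)

Section Dot.
Variables (R : realType) (n : nat).
Implicit Types (u v w x y : 'rV[R]_n) (S T B : seq 'rV[R]_n).

Lemma dotE u x : dot u x = \sum_i u 0 i * x 0 i.
Proof. by rewrite /dot mxE; apply: eq_bigr => i _; rewrite mxE. Qed.

Lemma dotC u x : dot u x = dot x u.
Proof. by rewrite !dotE; apply: eq_bigr => i _; rewrite mulrC. Qed.

Lemma dotDl u v x : dot (u + v) x = dot u x + dot v x.
Proof. by rewrite /dot mulmxDl mxE. Qed.

Lemma dotZl a u x : dot (a *: u) x = a * dot u x.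
Proof. by rewrite /dot -scalemxAl mxE. Qed.

Lemma dotNl u x : dot (- u) x = - dot u x.
Proof. by rewrite -scaleN1r dotZl mulN1r. Qed.

Lemma dotBl u v x : dot (u - v) x = dot u x - dot v x.
Proof. by rewrite dotDl dotNl. Qed.

Lemma dot0l x : dot 0 x = 0.
Proof. by rewrite -(scale0r 0) dotZl mul0r. Qed.

Lemma dotDr u x y : dot u (x + y) = dot u x + dot u y.
Proof. by rewrite dotC dotDl !(dotC _ u). Qed.

Lemma dotZr a u x : dot u (a *: x) = a * dot u x.
Proof. by rewrite dotC dotZl (dotC _ u). Qed.

Lemma dotNr u x : dot u (- x) = - dot u x.
Proof. by rewrite dotC dotNl (dotC _ u). Qed.

Lemma dotBr u x y : dot u (x - y) = dot u x - dot u y.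
Proof. by rewrite dotDr dotNr. Qed.

Lemma dot0r x : dot x 0 = 0.
Proof. by rewrite dotC dot0l. Qed.

Lemma dot_suml I (r : seq I) (p : pred I) (F : I -> 'rV[R]_n) x :
  dot (\sum_(i <- r | p i) F i) x = \sum_(i <- r | p i) dot (F i) x.
Proof.
by apply: (big_morph (fun z => dot z x)) => [u v|]; rewrite ?dotDl ?dot0l.
Qed.

Lemma dot_sumr I (r : seq I) (p : pred I) (F : I -> 'rV[R]_n) x :
  dot x (\sum_(i <- r | p i) F i) = \sum_(i <- r | p i) dot x (F i).
Proof. by rewrite dotC dot_suml; apply: eq_bigr => i _; rewrite dotC. Qed.

Lemma dot_ge0 x : 0 <= dot x x.
Proof. by rewrite dotE; apply: sumr_ge0 => i _; rewrite -expr2 sqr_ge0. Qed.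

Lemma dot_eq0 x : (dot x x == 0) = (x == 0).
Proof.
apply/eqP/eqP => [|->]; last by rewrite dot0l.
rewrite dotE => /psumr_eq0P x0; apply/rowP => i; rewrite mxE.
apply/eqP; have /eqP := x0 (fun i _ => sqr_ge0 (x 0 i)) i isT.
by rewrite mulf_eq0 orbb.
Qed.

Lemma dot_gt0 x : x != 0 -> 0 < dot x x.
Proof. by move=> x0; rewrite lt_neqAle eq_sym dot_eq0 x0 dot_ge0. Qed.

Lemma unit_neq0 x : dot x x = 1 -> x != 0.
Proof. by move=> x1; rewrite -dot_eq0 x1 oner_neq0. Qed.

Lemma dot_unit_lt1 u w : dot u u = 1 -> dot w w = 1 -> w != u -> dot w u < 1.
Proof.
move=> u1 w1 wu; have : 0 < dot (w - u) (w - u) by rewrite dot_gt0 // subr_eq0.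
by rewrite dotBl !dotBr u1 w1 (dotC u w); lra.
Qed.

Lemma dot_span0 S d x :
  {in S, forall s, dot s d = 0} -> x \in <<S>>%VS -> dot x d = 0.
Proof.
move=> Sd /(@coord_span _ _ _ (in_tuple S)) ->.
rewrite dot_suml big1 // => i _; rewrite dotZl Sd ?mulr0 //.
exact/mem_nth/(ltn_ord i).
Qed.

Lemma dim_rV : \dim {:'rV[R]_n} = n.
Proof. by rewrite dimvf /dim /= mul1n. Qed.

Lemma free_size_full S : free S -> size S = n -> <<S>>%VS = fullv.
Proof.
move=> /eqP fS sS; apply/eqP; rewrite eqEdim subvf /=.
by rewrite [X in (_ <= X)%N]fS sS dim_rV.
Qed.

Lemma free_prescribe B (f : 'rV[R]_n -> R) :
  free B -> exists x, {in B, forall b, dot b x = f b}.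
Proof.
move=> fB.
have [g /(_ fB)] := @linear_of_free _ _ R^o B (map f B).
rewrite size_map => /(_ erefl) gB.
(* The values of [g] on the standard basis are the coordinates of the vector representing [g]. *)
exists (\row_j g (delta_mx 0 j)) => b bB.
have /eq_in_map/(_ b bB) <- := gB.
rewrite {2}(row_sum_delta b) linear_sum dotE.
by apply: eq_bigr => j _; rewrite linearZ mxE.
Qed.

Lemma free_subset_span S :
  exists B, [/\ {subset B <= S}, free B & <<B>>%VS = <<S>>%VS].
Proof.
elim: S => [|a S [B [BS fB sB]]]; first by exists [::]; rewrite nil_free.
have [aB|aB] := boolP (a \in <<B>>%VS).
  exists B; split=> //; first by move=> b /BS bS; rewrite inE bS orbT.
  rewrite span_cons -sB; apply/esym/addv_idPr.
  by rewrite -memvE.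
exists (a :: B); rewrite free_cons aB; split=> //; last first.
  by rewrite !span_cons sB.
by move=> b; rewrite !inE => /orP[->//|/BS->]; rewrite orbT.
Qed.

Lemma orthogonal_vector S :
  <<S>>%VS != fullv -> exists2 d, d != 0 & {in S, forall s, dot s d = 0}.
Proof.
have [B [BS fB sB]] := free_subset_span S; rewrite -sB => nfull.
have [x xB] : exists x, x \notin <<B>>%VS.
  apply: contrapT => /forallNP xB; case/negP: nfull; apply/eqP/vspaceP => x.
  by rewrite memvf; apply/negPn/negP/xB.
have fxB : free (x :: B) by rewrite free_cons xB.
(* Prescribing 1 on a vector [x] outside the span and 0 on a basis of the span makes [d] nonzero and
   orthogonal to [S]. *)
have [d dE] := free_prescribe (fun b => (b == x)%:R) fxB.
exists d => [|s sS].
  apply/eqP => d0; have := dE x (mem_head _ _).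
  by rewrite d0 dot0r eqxx => /esym/eqP; rewrite oner_eq0.
apply: (@dot_span0 B) => [b bB|]; last by rewrite sB memv_span.
rewrite dE ?inE ?bB ?orbT //.
by case: eqP => // bx; rewrite -bx memv_span in xB.
Qed.

End Dot.

Lemma seq_argmin (R : realType) (T : eqType) (f : T -> R) (S : seq T) x0 :
  x0 \in S -> exists2 x, x \in S & {in S, forall y, f x <= f y}.
Proof.
elim: S x0 => // a [_ x0 _|b S IH x0 _].
  by exists a => [|y]; rewrite inE // => /eqP->.
have [x xS xmin] := IH b (mem_head _ _).
have [ax|xa] := leP (f a) (f x).
  exists a => [|y]; rewrite inE ?eqxx // => /orP[/eqP->//|/xmin].
  exact: le_trans.
exists x => [|y]; first by rewrite inE xS orbT.
by rewrite inE => /orP[/eqP->|/xmin//]; rewrite ltW.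
Qed.

(** * Finitely generated cones: Farkas and Caratheodory *)

Section Cone.
Variables (R : realType) (n : nat).
Implicit Types (u v w x y : 'rV[R]_n) (S T B U V : seq 'rV[R]_n).

(** The conical hull, peeled off one generator at a time so that proofs go by induction on the list,
    without indexed coefficients. *)
Fixpoint cone S x : Prop :=
  if S is a :: S' then exists2 t, 0 <= t & cone S' (x - t *: a) else x = 0.

Lemma cone0 S : cone S 0.
Proof. by elim: S => //= a S IH; exists 0 => //; rewrite scale0r subr0. Qed.

Lemma coneD S x y : cone S x -> cone S y -> cone S (x + y).
Proof.
elim: S x y => [|a S IH] x y /=; first by move=> -> ->; rewrite addr0.
move=> [s s0 xS] [t t0 yS]; exists (s + t); first exact: addr_ge0.
by rewrite scalerDl opprD addrACA; apply: IH.
Qed.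

Lemma coneZ S a x : 0 <= a -> cone S x -> cone S (a *: x).
Proof.
move=> a0; elim: S x => [|b S IH] x /=; first by move->; rewrite scaler0.
move=> [t t0 xS]; exists (a * t); first exact: mulr_ge0.
by rewrite -scalerA -scalerBr; apply: IH.
Qed.

Lemma cone_mem S w : w \in S -> cone S w.
Proof.
elim: S => //= a S IH; rewrite inE => /orP[/eqP->|/IH wS].
  by exists 1 => //; rewrite scale1r subrr; apply: cone0.
by exists 0 => //; rewrite scale0r subr0.
Qed.

Lemma cone_sum S (I : eqType) (r : seq I) (F : I -> 'rV[R]_n) :
  {in r, forall i, cone S (F i)} -> cone S (\sum_(i <- r) F i).
Proof.
move=> FS; rewrite big_seq; elim/big_ind: _ => //; first exact: cone0.
exact: coneD.
Qed.

Lemma cone_trans S V x :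
  {in S, forall w, cone V w} -> cone S x -> cone V x.
Proof.
elim: S x => [|a S IH] x SV /=; first by move->; apply: cone0.
move=> [t t0 /IH xS]; rewrite -(subrK (t *: a) x); apply: coneD.
  by apply: xS => w wS; apply: SV; rewrite inE wS orbT.
by apply: coneZ => //; apply: SV; rewrite mem_head.
Qed.

Lemma cone_sub S V x : {subset S <= V} -> cone S x -> cone V x.
Proof. by move=> SV; apply: cone_trans => w /SV; apply: cone_mem. Qed.

Lemma cone_dot_le0 S x v :
  {in S, forall w, dot w v <= 0} -> cone S x -> dot x v <= 0.
Proof.
elim: S x => [|a S IH] x Sv /=; first by move->; rewrite dot0l.
move=> [t t0 /IH xS]; rewrite -(subrK (t *: a) x) dotDl dotZl.
rewrite -[0]addr0 lerD //.
  by apply: xS => w wS; rewrite Sv // inE wS orbT.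
by rewrite mulr_ge0_le0 // Sv // mem_head.
Qed.

Lemma cone_span S x : cone S x -> x \in <<S>>%VS.
Proof.
elim: S x => [|a S IH] x /=; first by move->; rewrite mem0v.
move=> [t t0 /IH xS]; rewrite -(subrK (t *: a) x) addrC span_cons.
by apply: memv_add => //; rewrite memvZ // memv_line.
Qed.

Lemma span_cone S B x :
  {in B, forall b, cone S b /\ cone S (- b)} -> x \in <<B>>%VS -> cone S x.
Proof.
move=> BS /(@coord_span _ _ _ (in_tuple B)) ->.
apply: cone_sum => i _; move: (coord _ _ _) => c.
have [bS nbS] := BS _ (mem_nth 0 (ltn_ord i)).
have [c0|c0] := leP 0 c; first exact: coneZ.
by rewrite -[c]opprK scaleNr -scalerN; apply: coneZ => //; rewrite oppr_ge0 ltW.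
Qed.

Lemma cone_coef S x : uniq S -> cone S x ->
  exists2 c : 'rV[R]_n -> R, forall w, 0 <= c w & x = \sum_(w <- S) c w *: w.
Proof.
elim: S x => [|a S IH] x /=.
  by move=> _ ->; exists (fun=> 0); rewrite ?big_nil.
move=> /andP[aS uS] [t t0 /(IH _ uS)[c c0 xE]].
exists (fun w => if w == a then t else c w) => [w|]; first by case: ifP.
rewrite big_cons eqxx -[LHS](subrK (t *: a)) addrC xE; congr (_ + _).
rewrite !big_seq; apply: eq_bigr => w wS.
by case: eqP => // wa; rewrite -wa wS in aS.
Qed.

(* Induction on the number of generators, projecting along the last one
   (Bartl's proof). *)
Lemma farkas S x :
  cone S x \/ exists2 v, 0 < dot x v & {in S, forall w, dot w v <= 0}.
Proof.
move: {2}(size S) (erefl (size S)) => m; elim: m S x => [|m IH] [|a S] x //=.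
  move=> _; have [->|x0] := eqVneq x 0; first by left.
  by right; exists x => //; apply: dot_gt0.
move=> [sS]; have [xS|[v xv Sv]] := IH S x sS.
  by left; exists 0 => //; rewrite scale0r subr0.
have [av|av] := leP (dot a v) 0.
  by right; exists v => // w; rewrite inE => /orP[/eqP->|/Sv].
(* Projection along [a] onto the hyperplane orthogonal to [v]. As [dot w v <= 0] on [S] and
   [dot x v > 0], lifting back from [p] only adds nonnegative multiples of [a]. *)
pose p w := w - (dot w v / dot a v) *: a.
have [|pxS|[y pxy Sy]] := IH (map p S) (p x); first by rewrite size_map.
  left; change (cone (a :: S) x).
  have aC : cone (a :: S) a by apply: cone_mem; rewrite mem_head.
  rewrite -(subrK ((dot x v / dot a v) *: a) x); apply: coneD; last first.
    by apply: coneZ => //; rewrite divr_ge0 // ltW.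
  apply: cone_trans pxS => _ /mapP[w wS ->]; rewrite /p -scaleNr.
  apply: coneD; first by apply: cone_mem; rewrite inE wS orbT.
  by apply: coneZ => //; rewrite -mulNr divr_ge0 ?oppr_ge0 ?Sv // ltW.
(* Composing [y] with [p] keeps its signs on [S] and at [x] and makes it vanish on [a], since
   [p a = 0]. *)
right; have pE w : dot w (y - (dot a y / dot a v) *: v) = dot (p w) y.
  by rewrite dotBr dotZr dotBl dotZl; ring.
exists (y - (dot a y / dot a v) *: v) => [|w]; first by rewrite pE.
rewrite inE pE => /orP[/eqP->|wS]; last by apply: Sy; apply: map_f.
by rewrite /p divff ?gt_eqF // scale1r subrr dot0l.
Qed.

(** Supplies the exchange direction for Caratheodory modulo the span of [B]; negating the relation
    if needed makes some coefficient positive. *)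
Lemma dependency_mod B S :
  free B -> uniq S -> ~~ free (S ++ B) ->
  exists2 d : 'rV[R]_n -> R, \sum_(s <- S) d s *: s \in <<B>>%VS &
    exists2 s, s \in S & 0 < d s.
Proof.
move=> fB; suff dep : uniq S -> ~~ free (S ++ B) ->
  exists2 d : 'rV[R]_n -> R, \sum_(s <- S) d s *: s \in <<B>>%VS &
    exists2 s, s \in S & d s != 0.
  move=> uS /(dep uS)[d dB [s sS]]; rewrite neq_lt => /orP[ds|ds]; last first.
    by exists d => //; exists s.
  exists (fun s => - d s); last by exists s; rewrite // oppr_gt0.
  by rewrite (eq_bigr _ (fun s _ => scaleNr (d s) s)) sumrN memvN.
elim: S => [|a S IH] /=; first by rewrite fB.
move=> /andP[aS uS]; rewrite free_cons negb_and negbK.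
have skip (d : 'rV[R]_n -> R) t :
    \sum_(s <- a :: S) (if s == a then t else d s) *: s =
    t *: a + \sum_(s <- S) d s *: s.
  rewrite big_cons eqxx; congr (_ + _); rewrite !big_seq.
  by apply: eq_bigr => w wS; case: eqP => // wa; rewrite -wa wS in aS.
have [fSB|nfSB _] := boolP (free (S ++ B)); last first.
  have [d dB [s sS ds]] := IH uS nfSB.
  exists (fun s => if s == a then 0 else d s).
    by rewrite skip scale0r add0r.
  exists s; first by rewrite inE sS orbT.
  by case: (s =P a) => // sa; rewrite -sa sS in aS.
rewrite orbF span_cat => /memv_addP[y yS [b bB aE]].
have [d yE _] := free_span (catl_free fSB) yS.
exists (fun s => if s == a then -1 else d s); last first.
  by exists a; rewrite ?mem_head // eqxx oppr_eq0 oner_neq0.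
by rewrite skip -yE aE scaleN1r opprD addrAC addNr add0r memvN.
Qed.

Lemma caratheodory_mod B S x (c : 'rV[R]_n -> R) :
  free B -> uniq S -> {in S, forall s, 0 <= c s} ->
  x - \sum_(s <- S) c s *: s \in <<B>>%VS ->
  exists T (d : 'rV[R]_n -> R), [/\ {subset T <= S}, free (T ++ B),
    {in T, forall t, 0 < d t} & x - \sum_(t <- T) d t *: t \in <<B>>%VS].
Proof.
move=> fB; move: {2}(size S) (leqnn (size S)) => m.
elim: m S c => [|m IH] S c.
  by case: S => // _ _ _ xB; exists [::], c.
move=> sS uS c0 xB.
have drop0 (c1 : 'rV[R]_n -> R) s1 : s1 \in S -> c1 s1 = 0 ->
    {in S, forall s, 0 <= c1 s} ->
    x - \sum_(s <- S) c1 s *: s \in <<B>>%VS ->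
  exists T (d : 'rV[R]_n -> R), [/\ {subset T <= S}, free (T ++ B),
    {in T, forall t, 0 < d t} & x - \sum_(t <- T) d t *: t \in <<B>>%VS].
  move=> s1S c1s1 c1_ge0 xB1.
  have [||||T [d [TS fTB d0 xd]]] := IH (rem s1 S) c1.
  - by rewrite size_rem // -ltnS prednK //; case: (S) s1S.
  - exact: rem_uniq.
  - by move=> s /mem_rem; apply: c1_ge0.
  - move: xB1; rewrite (perm_big _ (perm_to_rem s1S)) /= big_cons c1s1 scale0r.
    by rewrite add0r.
  by exists T, d; split=> // t /TS /mem_rem.
have [|cpos] := boolP (has (fun s => c s == 0) S).
  by move=> /hasP[s1 s1S /eqP cs1]; apply: (drop0 c s1).
have {}cpos : {in S, forall s, 0 < c s}.
  move=> s sS'; rewrite lt_neqAle eq_sym c0 // andbT.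
  by apply: contra cpos => cs; apply/hasP; exists s.
have [fSB|nfSB] := boolP (free (S ++ B)); first by exists S, c; split.
have [d dB [s0 s0S ds0]] := dependency_mod fB uS nfSB.
(* The least ratio over positive [d s] is the largest multiple of [d] that can be subtracted. *)
have [|s1] := @seq_argmin R _ (fun s => c s / d s) [seq s <- S | 0 < d s] s0.
  by rewrite mem_filter ds0.
rewrite mem_filter => /andP[ds1 s1S] s1min.
pose th := c s1 / d s1.
have th0 : 0 <= th by rewrite divr_ge0 ?c0 // ltW.
apply: (drop0 (fun s => c s - th * d s) s1) => //.
- by rewrite /th divfK ?subrr // gt_eqF.
- move=> s sS'; rewrite subr_ge0; have [ds|ds] := leP (d s) 0.
    by apply: le_trans (c0 _ sS'); rewrite mulr_ge0_le0.
  by rewrite -ler_pdivlMr //; apply: s1min; rewrite mem_filter ds.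
rewrite (eq_bigr (fun s => c s *: s - th *: (d s *: s))); last first.
  by move=> s _; rewrite scalerBl scalerA.
by rewrite sumrB -scaler_sumr opprB addrCA addrC memvD // memvZ.
Qed.

End Cone.

(** Homogenization: at height 1 convex combinations become conical ones, and in a separating
    functional the height coordinate adds the same constant on both sides. *)
Lemma farkas_conv (R : realType) (n : nat) (S : seq 'rV[R]_n) (x : 'rV[R]_n) :
  uniq S ->
  conv S x \/ exists v, {in S, forall w, dot w v < dot x v}.
Proof.
move=> uS; pose lift z : 'rV[R]_(1 + n) := row_mx (const_mx 1) z.
have lift_inj : injective lift by move=> y z /eq_row_mx[].
have dotl y (v : 'rV_(1 + n)) :
    dot (lift y) v = v 0 (lshift n ord0) + dot y (rsubmx v).
  rewrite dotE big_split_ord /= big_ord1 /lift !row_mxEl mxE mul1r.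
  by congr (_ + _); rewrite dotE; apply: eq_bigr => i _; rewrite !row_mxEr mxE.
have [xS|[v xv Sv]] := farkas (map lift S) (lift x).
  left; have [|c c0] := cone_coef _ xS; first by rewrite map_inj_uniq.
  have -> : \sum_(w <- map lift S) c w *: w =
      row_mx (const_mx (\sum_(w <- S) c (lift w)))
             (\sum_(w <- S) c (lift w) *: w).
    elim: (S) => [|w V IH]; first by rewrite !big_nil row_mx0.
    rewrite !big_cons IH /lift scale_row_mx add_row_mx; congr row_mx.
    by apply/rowP => i; rewrite !mxE mulr1.
  move=> /eq_row_mx[/rowP/(_ 0)]; rewrite !mxE => c1 xE.
  exists (fun i => c (lift S`_i)); split=> [i|]; first exact: c0.
  rewrite -(big_mkord xpredT (fun i => c (lift S`_i))).
  rewrite -(big_mkord xpredT (fun i => c (lift S`_i) *: S`_i)).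
  rewrite -(big_nth 0 xpredT (fun w => c (lift w))).
  by rewrite -(big_nth 0 xpredT (fun w => c (lift w) *: w)).
right; exists (rsubmx v) => w wS.
have := Sv _ (map_f lift wS); rewrite dotl => /le_lt_trans/(_ xv).
by rewrite dotl ltrD2l.
Qed.


(** * Finite enumeration and small positive steps *)

Lemma enum_of_injective (T : eqType) (M : finType) (f : T -> M)
    (P : T -> Prop) :
  (forall x y, P x -> P y -> f x = f y -> x = y) ->
  exists2 V : seq T, uniq V & forall x, x \in V <-> P x.
Proof.
move=> f_inj.
(* Classical choice inverts [f] on the image of [P]; injectivity makes the chosen preimage the only
   one. *)
pose g m := if pselect (exists x, P x /\ f x = m) is left e
            then Some (projT1 (cid e)) else None.
exists (undup (pmap g (enum M))); first exact: undup_uniq.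
move=> x; rewrite mem_undup mem_pmap; split=> [/mapP[m _]|Px].
  by rewrite /g; case: pselect => // e [->]; case: cid => y [].
apply/mapP; exists (f x); first by rewrite mem_enum.
rewrite /g; case: pselect => [e|[]]; last by exists x.
by case: cid => y /= [Py /f_inj->].
Qed.

Lemma small_step (R : realType) (T : eqType) (S : seq T) (f g : T -> R) :
  {in S, forall x, 0 < f x} ->
  exists2 e, 0 < e & {in S, forall x, e * g x < f x}.
Proof.
elim: S => [|a S IH] fS; first by exists 1.
have [|e e0 eS] := IH; first by move=> x xS; rewrite fS // inE xS orbT.
have fa : 0 < f a by rewrite fS // mem_head.
have ga : 0 < `|g a| + 1 by rewrite ltr_wpDl.
have small k x : 0 < k -> 0 < f x -> k <= e -> e * g x < f x -> k * g x < f x.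
  move=> k0 fx ke; have [gx _|gx] := leP (g x) 0.
    by apply: le_lt_trans fx; rewrite mulr_ge0_le0 // ltW.
  by apply: le_lt_trans; rewrite ler_pM2r.
(* The added 1 keeps the denominator positive when [g a = 0] and makes the bound strict. *)
have k0 : 0 < Num.min e (f a / (`|g a| + 1)) by rewrite lt_min e0 divr_gt0.
exists (Num.min e (f a / (`|g a| + 1))) => // x.
rewrite inE => /orP[/eqP->|xS]; last first.
  by apply: small; rewrite ?eS ?ge_min ?lexx // fS // inE xS orbT.
have [ga0|ga0] := leP (g a) 0.
  by apply: le_lt_trans fa; rewrite mulr_ge0_le0 // ltW.
apply: (@le_lt_trans _ _ (f a / (`|g a| + 1) * g a)).
  by rewrite ler_pM2r // ge_min lexx orbT.
rewrite mulrAC ltr_pdivrMr // ltr_pM2l //.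
by rewrite (le_lt_trans (ler_norm _)) // ltrDl.
Qed.

(** * Affine independence and the direction of a facet normal *)

Section Affine.
Variables (R : realType) (n : nat).
Implicit Types (u v w x y p : 'rV[R]_n) (S T B D : seq 'rV[R]_n).

Lemma free_coef B (c : 'rV[R]_n -> R) :
  free B -> \sum_(b <- B) c b *: b = 0 -> {in B, forall b, c b = 0}.
Proof.
move=> fB cB b bB; have [k _ kU] := free_span fB (mem0v <<B>>).
rewrite (kU c) // -(kU (fun=> 0)) //.
by rewrite big1 // => x _; rewrite scale0r.
Qed.

Lemma affine_indep_coef S : uniq S ->
  (forall c : 'rV[R]_n -> R, \sum_(x <- S) c x = 0 ->
     \sum_(x <- S) c x *: x = 0 -> {in S, forall x, c x = 0}) ->
  affine_indep S.
Proof.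
move=> uS cS c c0 cx0 i.
pose d x := oapp c 0 (insub (index x S)).
have dE (j : 'I_(size S)) : d S`_j = c j by rewrite /d index_uniq // valK.
rewrite -dE; apply: cS (mem_nth 0 (ltn_ord i)).
  by rewrite (big_nth 0) big_mkord -[RHS]c0; apply: eq_bigr => j _; rewrite dE.
by rewrite (big_nth 0) big_mkord -[RHS]cx0; apply: eq_bigr => j _; rewrite dE.
Qed.

Lemma affine_indep_free p S :
  affine_indep (p :: S) -> free [seq x - p | x <- S].
Proof.
move=> aS; apply/(@freeP _ _ _ (map_tuple (fun x => x - p) (in_tuple S))).
move=> k k0 i.
(* The coefficient of [p] is chosen so that all coefficients sum to zero. *)
pose c (j : 'I_(size S).+1) := oapp k (- \sum_i k i) (unlift ord0 j).
have c_lift j : c (lift ord0 j) = k j by rewrite /c liftK.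
have c_0 : c ord0 = - \sum_i k i by rewrite /c unlift_none.
have c_sum : \sum_(j < (size S).+1) c j = 0.
  rewrite big_ord_recl c_0 -[RHS](addNr (\sum_i k i)); congr (_ + _).
  by apply: eq_bigr => j _; apply: c_lift.
have c_comb : \sum_(j < (size S).+1) c j *: (p :: S)`_j = 0.
  rewrite big_ord_recl c_0 (eq_bigr (fun j => k j *: S`_j)); last first.
    by move=> j _; rewrite c_lift.
  rewrite -[RHS]k0 scaleNr scaler_suml -sumrN -big_split.
  by apply: eq_bigr => j _ /=; rewrite (nth_map 0) // scalerBr addrC.
by rewrite -c_lift; apply: aS c_sum c_comb _.
Qed.

Lemma affine_indep_translate B g :
  free B -> affine_indep [seq b + g | b <- B].
Proof.
move=> fB; apply: affine_indep_coef => [|c].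
  by rewrite map_inj_uniq ?free_uniq //; apply: addIr.
rewrite !big_map => c0.
under eq_bigr do rewrite scalerDr.
rewrite big_split /= -scaler_suml c0 scale0r addr0 => /(free_coef fB) cB.
by move=> _ /mapP[b bB ->]; apply: cB.
Qed.

Lemma affine_indep_star p D e : free D -> e != 0 ->
  affine_indep (p :: [seq p + e *: d | d <- D]).
Proof.
move=> fD e0; apply: affine_indep_coef => [|c].
  rewrite /= map_inj_uniq ?free_uniq // ?andbT; last first.
    by move=> x y /addrI/(scalerI e0).
  apply/mapP => -[d dD /eqP].
  rewrite -{1}[p]addr0 (inj_eq (addrI p)) eq_sym scaler_eq0 (negPf e0) /=.
  by apply/negP/(free_not0 fD).
rewrite !big_cons !big_map => c0.
under eq_bigr do rewrite scalerDr scalerA.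
rewrite big_split /= -scaler_suml addrA -scalerDl c0 scale0r add0r.
move=> /(free_coef fD) cD.
have {}cD : {in D, forall d, c (p + e *: d) = 0}.
  by move=> d /cD/eqP; rewrite mulf_eq0 (negPf e0) orbF => /eqP.
move: c0; rewrite big_seq big1 // addr0 => cp x.
by rewrite inE => /orP[/eqP->//|/mapP[d dD ->]]; apply: cD.
Qed.

Lemma has_aff_indep_star (A : 'rV[R]_n -> Prop) p D e k :
  free D -> (size D).+1 = k -> e != 0 -> A p ->
  {in D, forall d, A (p + e *: d)} -> has_aff_indep A k.
Proof.
move=> fD <- e0 Ap AD; exists (p :: [seq p + e *: d | d <- D]).
rewrite /= size_map; split=> //; split; last exact: affine_indep_star.
by move=> x; rewrite inE => /orP[/eqP->//|/mapP[d dD ->]]; apply: AD.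
Qed.

Lemma orthogonal_complement_basis u : u != 0 ->
  exists D, [/\ free D, (size D).+1 = n & {in D, forall d, dot u d = 0}].
Proof.
move=> u0; have uu := dot_gt0 u0.
pose p x := x - (dot u x / dot u u) *: u.
have up x : dot u (p x) = 0 by rewrite dotBr dotZr divfK ?subrr // gt_eqF.
(* The projections of a basis of the whole space span the complement of [u]; [D] is a basis taken
   among them. *)
have [D [Dp fD sD]] := free_subset_span (map p (vbasis fullv)).
have Du : {in D, forall d, dot u d = 0}.
  by move=> d /Dp/mapP[x _ ->].
exists D; split=> //.
have fuD : free (u :: D).
  rewrite free_cons fD andbT; apply: contraL uu => uD.
  by rewrite (@dot_span0 _ _ D) ?ltxx // => d /Du; rewrite dotC.
suff fullD : <<u :: D>>%VS = fullv.
  by move: fuD; rewrite /free fullD dim_rV => /eqP.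
apply/eqP; rewrite eqEsubv subvf /= -(span_basis (vbasisP fullv)).
apply/span_subvP => x xB; rewrite -(subrK ((dot u x / dot u u) *: u) x) addrC.
rewrite span_cons sD memv_add ?memvZ ?memv_line //.
exact/memv_span/map_f.
Qed.

(** The [n] points give [n - 1] independent differences, orthogonal to [u] and [w]. Together with
    [u] they span the space, and [w - dot u w *: u] is orthogonal to all of them. *)
Lemma has_aff_indep_normal_collinear (A : 'rV[R]_n -> Prop) u w : (0 < n)%N ->
  has_aff_indep A n -> dot u u = 1 ->
  (forall x y, A x -> A y -> dot u x = dot u y) ->
  (forall x y, A x -> A y -> dot w x = dot w y) ->
  w = dot u w *: u.
Proof.
move=> n0 [[|p S] [sS [SA aS]]] u1 Au Aw; first by rewrite -sS in n0.
have := affine_indep_free aS; set D := map _ _ => fD.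
have orth z : (forall x y, A x -> A y -> dot z x = dot z y) ->
    {in D, forall d, dot d z = 0}.
  move=> Az _ /mapP[x xS ->]; rewrite dotC dotBr (Az x p) ?subrr //.
    by apply: SA; rewrite inE xS orbT.
  by apply: SA; rewrite mem_head.
have Du := orth _ Au; have Dw := orth _ Aw.
have fuD : free (u :: D).
  rewrite free_cons fD andbT; apply: contraTN isT => uD.
  by have := unit_neq0 u1; rewrite -dot_eq0 (dot_span0 Du uD) eqxx.
have full : <<u :: D>>%VS = fullv.
  by apply: free_size_full => //; rewrite /= size_map.
apply/eqP; rewrite -subr_eq0 -dot_eq0; apply/eqP.
apply: (@dot_span0 _ _ (u :: D)); last by rewrite full memvf.
move=> d; rewrite inE => /orP[/eqP->|dD]; rewrite dotBr dotZr.
  by rewrite u1; ring.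
by rewrite Du // Dw // mulr0 subrr.
Qed.

Lemma collinear_unit_eq u w :
  dot u u = 1 -> dot w w = 1 -> w = dot u w *: u -> 0 < dot u w -> u = w.
Proof.
move=> u1 w1 wE uw; move: w1.
rewrite wE dotZl dotZr u1 mulr1 => /eqP; rewrite -expr2 sqrf_eq1.
case/orP=> /eqP k; first by rewrite -[LHS]scale1r -k -wE.
by rewrite k ltr0N1 in uw.
Qed.

End Affine.

(** * Polyhedra given by inequalities: vertices and boundedness *)

Section Polyhedron.
Variables (R : realType) (n : nat).
Implicit Types (u v w x y p : 'rV[R]_n) (S T B D : seq 'rV[R]_n).
Implicit Types (h : 'rV[R]_n -> R).

Definition hpoly S h x : Prop := {in S, forall s, dot s x <= h s}.

(** A feasible [x] is a vertex exactly when these active constraints span the space. *)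
Definition tight S h x := [seq s <- S | dot s x == h s].

(* Move along a direction orthogonal to the tight constraints until a new one
   becomes tight; boundedness comes from v being in the cone of S. *)
Lemma vertex_above S h u v :
  (forall x, cone S x) -> hpoly S h u ->
  exists w, [/\ hpoly S h w, dot v u <= dot v w & <<tight S h w>>%VS = fullv].
Proof.
move=> Sfull.
move: {2}(n - _)%N (leqnn (n - \dim <<tight S h u>>)) => m.
elim: m u => [|m IH] u.
  rewrite leqn0 subn_eq0 => dT uS; exists u; split=> //.
  by apply/eqP; rewrite eqEdim subvf dim_rV.
move=> mT uS; have [full|/orthogonal_vector[d0 d0_neq0 d0T]] :=
  eqVneq <<tight S h u>>%VS fullv; first by exists u.
(* One of [d0] and [- d0] does not lower [dot v] and runs into a constraint. If [dot v d0] is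
   nonzero, this follows from [v] being in the cone of [S]; if it is zero, a constraint not
   orthogonal to [d0] decides the sign. *)
have [d [dT vd [s0 s0S s0d]]] : exists d,
    [/\ {in tight S h u, forall s, dot s d = 0}, 0 <= dot v d & exists2 s, s \in S & 0 < dot s d].
  have d0N : {in tight S h u, forall s, dot s (- d0) = 0}.
    by move=> s sT; rewrite dotNr d0T ?oppr0.
  have asc d : 0 < dot v d -> exists2 s, s \in S & 0 < dot s d.
    move=> vd; apply: contrapT => nex.
    have : dot v d <= 0.
      apply: cone_dot_le0 (Sfull v) => s sS; rewrite leNgt; apply/negP => sd.
      by apply: nex; exists s.
    by rewrite leNgt vd.
  case: (ltgtP (dot v d0) 0) => vd0; last first.
  - have [s sS] : exists2 s, s \in S & dot s d0 != 0.
      apply: contrapT => nex; case/negP: d0_neq0; rewrite -dot_eq0.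
      rewrite (@dot_span0 _ _ S) //; last exact: cone_span.
      by move=> s sS; apply/eqP/negPn/negP => sd; apply: nex; exists s.
    rewrite neq_lt => /orP[sd|sd].
      exists (- d0); rewrite dotNr vd0 oppr0; split=> //.
      by exists s; rewrite // dotNr oppr_gt0.
    by exists d0; rewrite vd0; split=> //; exists s.
  - by exists d0; split=> //; [exact: ltW|exact: asc].
  - exists (- d0); split=> //; first by rewrite dotNr oppr_ge0 ltW.
    by apply: asc; rewrite dotNr oppr_gt0.
(* Ratio test: [s1] is a first constraint reached along [d]. *)
have [|s1] := @seq_argmin R _ (fun s => (h s - dot s u) / dot s d)
  [seq s <- S | 0 < dot s d] s0; first by rewrite mem_filter s0d.
rewrite mem_filter => /andP[s1d s1S] s1min.
pose t := (h s1 - dot s1 u) / dot s1 d.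
have t0 : 0 <= t by apply: divr_ge0; [rewrite subr_ge0 uS | exact: ltW].
have feas : hpoly S h (u + t *: d).
  move=> s sS; rewrite dotDr dotZr; have [sd|sd] := leP (dot s d) 0.
    by rewrite -[h s]addr0 lerD ?uS // mulr_ge0_le0.
  rewrite -lerBrDl -ler_pdivlMr //; apply: s1min.
  by rewrite mem_filter sd.
suff dT' : (n - \dim <<tight S h (u + t *: d)>> <= m)%N.
  have [w [wS vw wT]] := IH _ dT' feas.
  exists w; split=> //; apply: le_trans vw.
  by rewrite dotDr dotZr lerDl mulr_ge0.
rewrite -ltnS; apply: leq_trans mT; apply: ltn_sub2l.
  rewrite ltnNge; apply/negP => dTn.
  have full : <<tight S h u>>%VS = fullv.
    by apply/eqP; rewrite eqEdim subvf dim_rV.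
  case/negP: d0_neq0; rewrite -dot_eq0 (dot_span0 d0T) //.
  by rewrite full memvf.
have sub : {subset s1 :: tight S h u <= tight S h (u + t *: d)}.
  move=> s; rewrite inE => /orP[/eqP->|sT].
    rewrite mem_filter s1S andbT dotDr dotZr /t divfK ?(gt_eqF s1d) //.
    by rewrite addrC subrK.
  have := sT; rewrite !mem_filter dotDr dotZr (dT _ sT) mulr0 addr0.
  by [].
(* The dimension grows: [d] is orthogonal to the old span but not to [s1]. *)
apply: leq_trans (dimvS (sub_span sub)).
rewrite ltnNge (geq_leqif (dimv_leqif_sup _)); last by rewrite span_cons addvSr.
apply/negP => /subvP/(_ s1 (memv_span (mem_head _ _))).
by move=> /(dot_span0 dT) s1d0; rewrite s1d0 ltxx in s1d.
Qed.

(** [V] lists the vertices, finitely many because the active constraints determine a vertex. A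
    feasible point outside their hull would be strictly separated by some [v], against
    [vertex_above]. *)
Lemma hpoly_polytope S h : (forall x, cone S x) -> polytope (hpoly S h).
Proof.
move=> Sfull.
have [x y [xS xT] [yS yT] xy|V uV VP] := @enum_of_injective _ _
  (fun x => map_tuple (fun s => dot s x == h s) (in_tuple S))
  (fun x => hpoly S h x /\ <<tight S h x>>%VS = fullv).
  have /eq_in_map xyS : map (fun s => dot s x == h s) S =
                        map (fun s => dot s y == h s) S by case: xy.
  apply/eqP; rewrite -subr_eq0 -dot_eq0; apply/eqP.
  apply: (@dot_span0 _ _ (tight S h x)); last by rewrite xT memvf.
  move=> s; rewrite mem_filter => /andP[sx sS].
  have := xyS s sS; rewrite /= sx dotBr (eqP sx) => /esym/eqP->.
  by rewrite subrr.
exists V => x; split=> [xS|[l [l0 [l1 ->]]]]; last first.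
  move=> s sS; rewrite dot_sumr -[h s]mul1r -l1 mulr_suml.
  apply: ler_sum => i _; rewrite dotZr ler_wpM2l //.
  by have [/(_ (mem_nth 0 (ltn_ord i)))[VS _] _] := VP V`_i; apply: VS.
have [//|[v vV]] := farkas_conv x uV.
have [w [wS vw wT]] := vertex_above v Sfull xS.
have /vV : w \in V by apply/VP.
by rewrite !(dotC _ v) ltNge vw.
Qed.

(** * Facet normals of a polyhedron with irredundant constraints *)

Section Normals.
Variables (S : seq 'rV[R]_n) (h : 'rV[R]_n -> R).
Hypothesis n0 : (0 < n)%N.
Hypothesis S1 : {in S, forall s, dot s s = 1}.
Hypothesis h0 : {in S, forall s, 0 < h s}.
(** Such a [y] is a relative interior point of the facet with normal [u]. *)
Hypothesis touch : {in S, forall u, exists2 y, dot u y = h u &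
  {in S, forall w, w != u -> dot w y < h w}}.

(** Active constraints do not increase along [D]; the inactive ones have slack, and [small_step]
    gives one step length for all pairs of an inactive constraint and a direction. *)
Lemma hpoly_step x D : hpoly S h x ->
  {in S, forall s, dot s x = h s -> {in D, forall d, dot s d <= 0}} ->
  exists2 e, 0 < e & {in D, forall d, hpoly S h (x + e *: d)}.
Proof.
move=> xS xD.
pose C := [seq (s, d) | s <- [seq s <- S | dot s x != h s], d <- D].
have [|e e0 eC] := @small_step R _ C (fun c => h c.1 - dot c.1 x)
                     (fun c => dot c.1 c.2).
  move=> _ /allpairsP[[s d] /= [+ dD ->]] /=.
  rewrite mem_filter => /andP[sx sS].
  by rewrite subr_gt0 lt_neqAle sx xS.
exists e => // d dD s sS; rewrite dotDr dotZr.
have [sx|sx] := eqVneq (dot s x) (h s).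
  rewrite -[leRHS]addr0 lerD ?xS //.
  by apply: mulr_ge0_le0; [exact: ltW | exact: (xD s)].
rewrite -lerBrDl ltW //; apply: (eC (s, d)).
by apply: allpairs_f; rewrite // mem_filter sx.
Qed.

Lemma hpoly_full_dim : full_dim (hpoly S h).
Proof.
have fD := basis_free (vbasisP {:'rV[R]_n}).
have sD : size (vbasis {:'rV[R]_n}) = n by rewrite size_tuple dim_rV.
have hp0 : hpoly S h 0 by move=> s sS; rewrite dot0r ltW ?h0.
have [s sS s0|e e0 eD] := hpoly_step (D := vbasis {:'rV[R]_n}) hp0.
  by have := h0 sS; rewrite -s0 dot0r ltxx.
by apply: has_aff_indep_star fD _ (lt0r_neq0 e0) hp0 eD; rewrite sD.
Qed.

Lemma face_hpoly u x : u \in S ->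
  face (hpoly S h) u x <-> hpoly S h x /\ dot u x = h u.
Proof.
move=> uS; have [y uy yS] := touch uS.
have yh : hpoly S h y.
  by move=> w wS; have [->|wu] := eqVneq w u; rewrite ?uy // ltW // yS.
split=> [[xh xmax]|[xh ux]]; split=> //; last first.
  by move=> z zh; rewrite ux; apply: zh.
by apply: le_anti; rewrite xh // -uy xmax.
Qed.

Lemma normals_hpoly u : normals (hpoly S h) u <-> u \in S.
Proof.
split=> [[u1 aff]|uS].
  have [pts [sP [pF aP]]] := aff.
  have nP : n%:R = \sum_(x <- pts) 1 :> R.
    by rewrite big_const_seq count_predT sP iter_addr_0.
  have nR : n%:R != 0 :> R by rewrite pnatr_eq0 -lt0n.
  (* The centroid of the [n] points of the face: a constraint tight at [m] is tight at all of
     them. *)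
  pose m := n%:R^-1 *: \sum_(x <- pts) x.
  have dotm v : dot v m = n%:R^-1 * \sum_(x <- pts) dot v x.
    by rewrite dotZr dot_sumr.
  have m_const v c : {in pts, forall x, dot v x = c} -> dot v m = c.
    move=> vc; rewrite dotm big_seq.
    rewrite (eq_bigr (fun=> c * 1)) => [|x /vc->]; last by rewrite mulr1.
    by rewrite -big_seq -mulr_sumr -nP mulrCA mulVf ?mulr1.
  have m_slack w : w \in S ->
      h w - dot w m = n%:R^-1 * \sum_(x <- pts) (h w - dot w x).
    move=> wS; rewrite sumrB mulrBr dotm; congr (_ - _).
    by rewrite -[h w]mulr1 -mulr_sumr -nP mulrCA mulVf ?mulr1.
  have slack_ge0 w : w \in S -> {in pts, forall x, 0 <= h w - dot w x}.
    by move=> wS x /pF[xh _]; rewrite subr_ge0 xh.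
  have mh : hpoly S h m.
    move=> w wS; rewrite -subr_ge0 m_slack // mulr_ge0 ?invr_ge0 //.
    by rewrite big_seq sumr_ge0 // => x; apply: slack_ge0.
  have [x0 x0P] : exists x0, x0 \in pts.
    have : (0 < size pts)%N by rewrite sP.
    by case: (pts) => // x0 l _; exists x0; rewrite mem_head.
  have u_const : {in pts, forall x, dot u x = dot u x0}.
    move=> x /pF[xh xmax]; have [x0h x0max] := pF _ x0P.
    by apply: le_anti; rewrite xmax // x0max.
  have um := m_const _ _ u_const.
  (* If [u] were not in the cone of the constraints tight at [m], a small step from [m] along [v]
     would stay feasible and increase [dot u]. *)
  have [uT|[v uv vT]] := farkas (tight S h m) u; last first.
    have [w wS wm d|e e0 /(_ v (mem_head _ _)) mv] :=
      hpoly_step (D := [:: v]) mh.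
      by rewrite inE => /eqP->; apply: vT; rewrite mem_filter wm eqxx.
    have [_ /(_ _ mv)] := pF _ x0P; rewrite dotDr um dotZr.
    by rewrite gerDl leNgt mulr_gt0.
  have [w wT uw] : exists2 w, w \in tight S h m & 0 < dot w u.
    apply: contrapT => nex; have := oner_neq0 R; rewrite -u1.
    case/negP; rewrite eq_le dot_ge0 andbT; apply: cone_dot_le0 uT => w wT.
    by rewrite leNgt; apply/negP => uw; apply: nex; exists w.
  move: wT; rewrite mem_filter => /andP[/eqP wm wS].
  suff -> : u = w by [].
  apply: collinear_unit_eq => //; [exact: S1| |by rewrite dotC].
  apply: (@has_aff_indep_normal_collinear _ _ (fun x => x \in pts)) => //.
  - by exists pts.
  - by move=> x y /u_const-> /u_const->.
  (* The nonnegative slacks of [w] at the points average to its slack at [m], which is zero. *)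
  - have : \sum_(x <- pts | x \in pts) (h w - dot w x) == 0.
      rewrite -big_seq -(inj_eq (mulfI (invr_neq0 nR))) -m_slack // wm.
      by rewrite subrr mulr0.
    rewrite psumr_eq0 => [/allP w0|x]; last exact: slack_ge0.
    have wx x : x \in pts -> dot w x = h w.
      by move=> xP; have := w0 x xP; rewrite xP subr_eq0 => /eqP->.
    by move=> x y /wx-> /wx->.
split; first exact: S1.
(* Only [u] is active at [y], so small steps along a basis of the complement of [u] stay in the face
   and yield [n] affinely independent points. *)
have [y uy yS] := touch uS.
have [D [fD sD Du]] := orthogonal_complement_basis (unit_neq0 (S1 uS)).
have yh : hpoly S h y.
  by move=> w wS; have [->|wu] := eqVneq w u; rewrite ?uy // ltW // yS.
have [w wS wy d dD|e e0 eD] := hpoly_step (D := D) yh.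
  have [->|wu] := eqVneq w u; first by rewrite Du.
  by have := yS _ wS wu; rewrite wy ltxx.
apply: (@has_aff_indep_star _ _ _ y D e) => //.
- by rewrite gt_eqF.
- exact/face_hpoly.
- move=> d dD; apply/face_hpoly => //; split; first exact: eD.
  by rewrite dotDr dotZr uy (Du d dD) mulr0 addr0.
Qed.

End Normals.
End Polyhedron.

(** * Facet normals of a polytope: finiteness and positive spanning *)

Section Normals.
Variables (R : realType) (n : nat).
Implicit Types (u v w x y p : 'rV[R]_n) (S T B D X : seq 'rV[R]_n).
Implicit Types (P Q : 'rV[R]_n -> Prop).

Lemma conv_mem S x : x \in S -> conv S x.
Proof.
move=> /(nthP 0)[k kS <-]; pose i := Ordinal kS.
exists (fun j => (j == i)%:R); split=> [j|]; first exact: ler0n.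
rewrite (bigD1 i) //= eqxx big1 ?addr0 => [|j /negPf-> //]; split=> //.
rewrite (bigD1 i) //= eqxx big1 ?addr0 ?scale1r // => j /negPf->.
by rewrite scale0r.
Qed.

Lemma dot_conv_le S x v c :
  conv S x -> {in S, forall s, dot s v <= c} -> dot x v <= c.
Proof.
move=> [l [l0 [l1 ->]]] Sc; rewrite dot_suml -[c]mul1r -l1 mulr_suml.
apply: ler_sum => i _; rewrite dotZl ler_wpM2l // Sc //.
exact/mem_nth/(ltn_ord i).
Qed.

Lemma conv_cone S x g : conv S x -> cone [seq s - g | s <- S] (x - g).
Proof.
move=> [l [l0 [l1 ->]]].
have -> : \sum_i l i *: S`_i - g = \sum_i l i *: (S`_i - g).
  under [RHS]eq_bigr do rewrite scalerBr.
  by rewrite sumrB -scaler_suml l1 scale1r.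
apply: cone_sum => i _; apply: coneZ => //.
exact/cone_mem/map_f/mem_nth/(ltn_ord i).
Qed.

(** A point of a face is a convex combination whose generators of nonzero weight all lie in that
    face. *)
Lemma face_sub S P u w : (forall x, P x <-> conv S x) ->
  {in S, forall s, face P u s -> face P w s} ->
  forall x, face P u x -> face P w x.
Proof.
move=> PS Suw x [Px xmax]; split=> // y Py.
have SP s : s \in S -> P s by move=> sS; apply/PS/conv_mem.
have [l [l0 [l1 xE]]] := (PS x).1 Px.
have Sl (i : 'I_(size S)) : S`_i \in S by apply/mem_nth/(ltn_ord i).
have lM : \sum_i l i * (dot u x - dot u S`_i) == 0.
  under eq_bigr do rewrite mulrBr; rewrite sumrB -mulr_suml l1 mul1r {1}xE.
  by rewrite dot_sumr subr_eq0; apply/eqP; apply: eq_bigr => i _; rewrite dotZr.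
rewrite psumr_eq0 in lM; last first.
  by move=> i _; rewrite mulr_ge0 // subr_ge0 xmax //; apply: SP.
rewrite xE dot_sumr -[dot w y]mul1r -l1 mulr_suml; apply: ler_sum => i _.
rewrite dotZr; have := allP lM i (mem_index_enum _); rewrite mulf_eq0.
case/orP=> [/eqP->|]; first by rewrite !mul0r.
rewrite subr_eq0 => /eqP ui; apply: ler_wpM2l => //.
have [_] : face P w S`_i; last by apply.
by apply: Suw => //; split=> [|z Pz]; [exact: SP|rewrite -ui xmax].
Qed.

Lemma full_dim_dot_const P u : full_dim P ->
  (forall x y, P x -> P y -> dot u x = dot u y) -> u = 0.
Proof.
move=> [[|p S] [//= [sS] [SP aS]]] Pu; apply/eqP; rewrite -dot_eq0; apply/eqP.
apply: (dot_span0 (S := [seq x - p | x <- S])) => [_ /mapP[x xS ->]|].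
  rewrite dotC dotBr (Pu x p) ?subrr //; apply: SP; rewrite inE ?eqxx //.
  by rewrite xS orbT.
rewrite free_size_full ?memvf //; first exact: affine_indep_free.
by rewrite size_map.
Qed.

(** A facet normal is determined by the generators lying on its facet, and there are finitely many
    sets of generators. *)
Lemma normals_enum P : (0 < n)%N -> polytope P -> full_dim P ->
  exists2 X : seq 'rV[R]_n, uniq X & forall u, u \in X <-> normals P u.
Proof.
move=> n0 [S PS] Pfull; apply: (enum_of_injective
  (f := fun u => map_tuple (fun s => `[< face P u s >]) (in_tuple S))).
move=> u w [u1 uA] [w1 wA] /(congr1 val)/= /eq_in_map uw.
have face_uw : forall x, face P u x -> face P w x.
  apply: face_sub PS _ => s sS /asboolP us.
  by apply/asboolP; rewrite -uw.
have const z x y : face P z x -> face P z y -> dot z x = dot z y.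
  by move=> [Px xmax] [Py ymax]; apply: le_anti; rewrite xmax // ymax.
have wE := has_aff_indep_normal_collinear n0 uA u1 (@const u)
  (fun x y ux uy => const w x y (face_uw x ux) (face_uw y uy)).
have [uw0|uw0] := ltP 0 (dot u w); first exact: collinear_unit_eq wE uw0.
(* Were [w] a negative multiple of [u], the common face would both maximize and minimize [dot u], so
   [P] would be flat. *)
have {}uw0 : dot u w < 0.
  rewrite lt_neqAle uw0 andbT; apply/eqP => uw'; move: (unit_neq0 w1).
  by rewrite wE uw' scale0r eqxx.
case/eqP: (unit_neq0 u1); apply: full_dim_dot_const Pfull _.
have [[|x S'] [sS' [S'A _]]] := uA; first by rewrite -sS' in n0.
have ux := S'A x (mem_head _ _); have [_ wmax] := face_uw _ ux.
have [_ umax] := ux.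
suff cst y : P y -> dot u y = dot u x by move=> y z /cst-> /cst->.
move=> Py; apply: le_anti; rewrite umax //=.
by have := wmax y Py; rewrite wE !dotZl ler_nM2l.
Qed.

(** Otherwise some [v] has [dot w v <= 0] for every facet normal [w]. A vertex, on the side of [v],
    of the polar of [P] about an interior point is a multiple of a facet normal and contradicts
    this. *)
Lemma cone_normals P X : polytope P -> full_dim P ->
  (forall u, u \in X <-> normals P u) -> forall x, cone X x.
Proof.
move=> [S PS] [[|p T] [//= [sT] [TP aT]]] XP x.
have [//|[v xv vX]] := farkas X x.
have v0 : v != 0 by apply: contraTneq xv => ->; rewrite dot0r ltxx.
pose g := n.+1%:R^-1 *: \sum_(y <- p :: T) y.
pose C := [seq s - g | s <- S].
have qsum : \sum_(y <- p :: T) (y - g) = 0.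
  rewrite sumrB big_const_seq count_predT [size _]/= sT iter_addr_0.
  by rewrite -[g *+ _]scaler_nat /g
    scalerA divff ?scale1r ?subrr // pnatr_eq0.
have qC : {in p :: T, forall y, cone C (y - g)}.
  by move=> y /TP/PS; apply: conv_cone.
have uT : uniq (p :: T).
  rewrite /=; have := free_uniq (affine_indep_free aT).
  rewrite map_inj_uniq; last exact: addIr.
  move=> ->; rewrite andbT; apply/negP => pT.
  have := free_not0 (affine_indep_free aT) (map_f (fun x => x - p) pT).
  by rewrite subrr eqxx.
(* The vectors [y - g] sum to zero, so the negative of each is the sum of the others; hence [C]
   positively spans the space. *)
have nqC : {in p :: T, forall y, cone C (- (y - g))}.
  move: (p :: T) qsum qC => U Usum UC y yT.
  have : \sum_(z <- U) (z - g) == 0 by rewrite Usum.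
  rewrite (perm_big _ (perm_to_rem yT)) /= big_cons addrC addr_eq0 => /eqP<-.
  by apply: cone_sum => z /mem_rem; apply: UC.
have Cfull y : cone C y.
  apply: (span_cone (B := [seq z - p | z <- T])); last first.
    rewrite free_size_full ?memvf //; first exact: affine_indep_free.
    by rewrite size_map.
  have pT := mem_head p T.
  move=> _ /mapP[z zT ->]; have {}zT : z \in p :: T by rewrite inE zT orbT.
  have -> : z - p = (z - g) + - (p - g) by rewrite opprB addrA subrK.
  split; first by apply: coneD; [apply: qC|apply: nqC].
  by rewrite [- (_ + - _)]opprD opprK; apply: coneD; [apply: nqC|apply: qC].
have [|e e0 eC] := @small_step R _ C (fun=> 1) (fun s => dot s v); first by [].
(* [hpoly C (fun=> 1)] is the polar of [P] translated by [- g]; it contains [e *: v] for small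
   [e]. *)
have [|w [wC vw wT]] := @vertex_above _ _ C (fun=> 1) (e *: v) v Cfull.
  by move=> s sC; rewrite dotZr ltW // eC.
have {}vw : 0 < dot v w.
  by apply: lt_le_trans vw; rewrite dotZr mulr_gt0 // dot_gt0.
have w0 : w != 0 by apply: contraTneq vw => ->; rewrite dot0r ltxx.
have ww := dot_gt0 w0; pose k := (Num.sqrt (dot w w))^-1.
have k0 : 0 < k by rewrite invr_gt0 sqrtr_gt0.
have kwX : k *: w \in X.
  apply/XP; split.
    rewrite dotZl dotZr mulrA -expr2 /k exprVn sqr_sqrtr ?ltW //.
    by rewrite mulVf // gt_eqF.
  (* The constraints tight at the vertex [w] contain a basis; translated back by [g] it gives [n]
     affinely independent generators on the face of [w]. *)
  have [B [BT fB sB]] := free_subset_span (tight C (fun=> 1) w).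
  exists [seq b + g | b <- B]; rewrite size_map; split.
    by move: fB; rewrite /free sB wT dim_rV => /eqP.
  split; last exact: affine_indep_translate.
  move=> _ /mapP[b /BT + ->]; rewrite mem_filter => /andP[/eqP bw].
  move=> /mapP[s sS bE]; have sE : s = b + g by rewrite bE subrK.
  rewrite -sE; split=> [|y /PS yS]; first exact/PS/conv_mem.
  rewrite !dotZl ler_pM2l //; rewrite ![dot w _]dotC.
  apply: dot_conv_le yS _ => z zS; rewrite -(lerD2r (- dot g w)) -!dotBl -bE bw.
  exact/wC/map_f.
by have := vX _ kwX; rewrite dotZl leNgt mulr_gt0 // dotC.
Qed.

End Normals.

(** * Strong monotypy restricts the signs of minimal relations *)

Section Circuits.
Variables (R : realType) (n : nat) (P : 'rV[R]_n -> Prop) (X : seq 'rV[R]_n).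
Hypotheses (n0 : (0 < n)%N) (Ppoly : polytope P) (Pfull : full_dim P).
Hypothesis XP : forall u, u \in X <-> normals P u.
Implicit Types (u v w x y : 'rV[R]_n) (C : seq 'rV[R]_n).

(* The support function of the segment [0, v] plus the unit ball. *)
Definition offset v w : R := 1 + Num.max 0 (dot w v).

Lemma offset_gt0 v w : 0 < offset v w.
Proof. by rewrite ltr_wpDr // le_max lexx. Qed.

Lemma normals_unit : {in X, forall u, dot u u = 1}.
Proof. by move=> u /XP[]. Qed.

(** The touching point is the end of the segment maximal in direction [u], plus the point [u] of the
    ball. Strictness comes from the ball: distinct unit vectors have product below 1. *)
Lemma offset_touch v : {in X, forall u, exists2 y, dot u y = offset v u &
  {in X, forall w, w != u -> dot w y < offset v w}}.
Proof.
move=> u uX; pose k : 'rV[R]_n := if 0 < dot u v then v else 0.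
have k_le w : dot w k <= Num.max 0 (dot w v).
  by rewrite /k; case: ifP; rewrite ?dot0r le_max lexx ?orbT.
exists (k + u) => [|w wX wu]; rewrite dotDr addrC.
  rewrite normals_unit // /offset /k maxElt; congr (_ + _).
  by case: ifP; rewrite ?dot0r.
apply: ltr_leD (k_le w); apply: dot_unit_lt1 => //; exact: normals_unit.
Qed.

Let Q v := hpoly X (offset v).

Lemma normals_offset v u : normals (Q v) u <-> normals P u.
Proof.
rewrite -XP; apply: normals_hpoly => //.
- exact: normals_unit.
- exact: offset_touch.
Qed.

Lemma realized_offset v sigma : realized_sign_vector (Q v) sigma <->
  exists x, {in X, forall u, sigma u = Num.sg (dot u x - offset v u)}.
Proof.
have faceQ u x : u \in X -> face (Q v) u x <-> Q v x /\ dot u x = offset v u.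
  by apply: face_hpoly; apply: offset_touch.
split=> -[x xsig]; exists x.
  move=> u uX; have [y uy yX] := offset_touch v uX.
  rewrite (xsig u _ y); [by rewrite uy|exact/normals_offset/XP|].
  apply/faceQ => //; split=> // w wX; have [->|/yX/ltW->//] := eqVneq w u.
  by rewrite uy.
move=> u /normals_offset/XP uX p /(faceQ _ _ uX)[_ ->]; exact: xsig.
Qed.

Lemma strongly_monotypic_offset v w sigma : strongly_monotypic P ->
  realized_sign_vector (Q v) sigma -> realized_sign_vector (Q w) sigma.
Proof.
move=> Psm; have Qsm z : arrangements_comb_equiv P (Q z).
  apply: Psm (normals_offset z).
    by apply: hpoly_polytope; apply: cone_normals Ppoly Pfull XP.
  apply: hpoly_full_dim; by move=> s _; apply: offset_gt0.
by move=> /(Qsm v sigma).2 /(Qsm w sigma).1.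
Qed.

(** On [C], [x] takes the value 2 where [e] is positive, balanced by a large value at [b0]; [v]
    raises the offset at [b0] by that same value and is itself balanced at [b1], where its value is
    at most 0 and leaves the offset at 1. *)
Lemma offset_separates C (e : 'rV[R]_n -> R) b0 b1 : uniq C ->
  (forall f, \sum_(c <- C) e c * f c = 0 ->
     exists x, {in C, forall c, dot c x = f c}) ->
  b0 \in C -> b1 \in C -> b0 != b1 -> e b0 < 0 -> e b1 < 0 ->
  exists v x, {in C, forall c, (0 < e c -> offset v c < dot c x) /\
                              (e c < 0 -> dot c x < offset v c)}.
Proof.
move=> uC real b0C b1C b01 eb0 eb1.
have delta b t : b \in C -> \sum_(c <- C) e c * ((c == b)%:R * t) = e b * t.
  move=> bC; rewrite (bigD1_seq b) //= eqxx mul1r big1 ?addr0 // => c /negPf->.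
  by rewrite mul0r mulr0.
pose s := \sum_(c <- C) e c * ((0 < e c)%R%:R * 2).
have s0 : 0 <= s.
  apply: sumr_ge0 => c _; case: (leP (e c) 0) => ec.
    by rewrite mul0r mulr0.
  by rewrite mul1r mulr_ge0 // ltW.
have [|v vE] := real (fun c =>
    (c == b0)%:R * (- s / e b0) + (c == b1)%:R * (s / e b1)).
  under eq_bigr do rewrite mulrDr.
  rewrite big_split /= !delta //.
  rewrite [_ * (- s / _)]mulrC [_ * (s / _)]mulrC !divfK ?lt_eqF //.
  by rewrite addNr.
have [|x xE] := real (fun c =>
    (0 < e c)%R%:R * 2 + (c == b0)%:R * (- s / e b0)).
  under eq_bigr do rewrite mulrDr.
  by rewrite big_split /= delta // [e b0 * _]mulrC divfK ?lt_eqF // subrr.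
exists v, x => c cC; rewrite /offset vE // xE //; split=> ec.
  have -> : (c == b0) = false.
    by apply: contraTF ec => /eqP->; rewrite -leNgt ltW.
  have -> : (c == b1) = false.
    by apply: contraTF ec => /eqP->; rewrite -leNgt ltW.
  by rewrite ec !mul0r !addr0 maxxx mul1r addr0 ltr1n.
rewrite (le_gtF (ltW ec)) mul0r add0r.
have [->|cb0] := eqVneq c b0.
  rewrite (negPf b01) mul0r addr0 mul1r ltr_pwDl //.
  by rewrite le_max lexx orbT.
by rewrite mul0r add0r ltr_pwDl // le_max lexx.
Qed.

(** Separation for [e] and for [- e] gives [x1] and [x2] with opposite signs on [C]. Strong monotypy
    moves the signs of [x1] to a point [x3] of the arrangement of [x2]; then [x3 - x2] has the sign
    of [e] on [C], so pairing it with the relation gives a positive sum instead of 0. *)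
Lemma strongly_monotypic_circuit C (e : 'rV[R]_n -> R) a0 a1 b0 b1 :
  strongly_monotypic P -> uniq C -> {subset C <= X} ->
  \sum_(c <- C) e c *: c = 0 ->
  (forall f, \sum_(c <- C) e c * f c = 0 ->
     exists x, {in C, forall c, dot c x = f c}) ->
  a0 \in C -> a1 \in C -> a0 != a1 -> 0 < e a0 -> 0 < e a1 ->
  b0 \in C -> b1 \in C -> b0 != b1 -> e b0 < 0 -> e b1 < 0 -> False.
Proof.
move=> Psm uC CX eC real a0C a1C a01 ea0 ea1 b0C b1C b01 eb0 eb1.
have [v1 [x1 x1P]] := offset_separates uC real b0C b1C b01 eb0 eb1.
have [|||v2 [x2 x2P]] :=
  @offset_separates C (fun c => - e c) a0 a1 uC _ a0C a1C a01.
- move=> f; under eq_bigr do rewrite mulNr; rewrite sumrN => /eqP.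
  by rewrite oppr_eq0 => /eqP; apply: real.
- by rewrite oppr_lt0.
- by rewrite oppr_lt0.
pose sigma u := Num.sg (dot u x1 - offset v1 u).
have [|x3 x3P] := (realized_offset v2 sigma).1.
  apply: (strongly_monotypic_offset v2 Psm)
    (_ : realized_sign_vector (Q v1) _).
  by apply/realized_offset; exists x1.
have pos : {in C, forall c, 0 < e c -> 0 < dot c (x3 - x2)}.
  move=> c cC ec; have := x3P c (CX c cC); rewrite /sigma gtr0_sg; last first.
    by rewrite subr_gt0; apply: (x1P c cC).1.
  move=> /esym/eqP; rewrite sgr_cp0 subr_gt0 dotBr subr_gt0; apply: lt_trans.
  by apply: (x2P c cC).2; rewrite oppr_lt0.
have neg : {in C, forall c, e c < 0 -> dot c (x3 - x2) < 0}.
  move=> c cC ec; have := x3P c (CX c cC); rewrite /sigma ltr0_sg; last first.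
    by rewrite subr_lt0; apply: (x1P c cC).2.
  move=> /esym/eqP; rewrite sgr_cp0 subr_lt0 dotBr subr_lt0 => /lt_trans; apply.
  by apply: (x2P c cC).1; rewrite oppr_gt0.
have : \sum_(c <- C | c \in C) e c * dot c (x3 - x2) == 0.
  apply/eqP; rewrite -big_seq -[RHS](dot0l (x3 - x2)) -[in RHS]eC dot_suml.
  by apply: eq_bigr => c _; rewrite dotZl.
rewrite psumr_eq0 => [/allP/(_ a0 a0C)|c cC].
  by rewrite a0C mulf_eq0 !gt_eqF // pos.
case: (ltgtP (e c) 0) => ec; last by rewrite ec mul0r.
  by rewrite mulr_le0 // ltW // neg.
by rewrite mulr_ge0 // ltW // pos.
Qed.

End Circuits.

(** * Minimal positive spanning sets and positive circuits *)

Section PositiveCircuits.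
Variables (R : realType) (n : nat).
Implicit Types (u v w x y : 'rV[R]_n) (X U Y T B : seq 'rV[R]_n).

Lemma minimal_cone_spanning X : (forall x, cone X x) ->
  exists U, [/\ {subset U <= X}, uniq U, forall x, cone U x &
                {in U, forall u, ~ cone (rem u U) u}].
Proof.
move=> Xfull; suff : uniq (undup X) -> (forall x, cone (undup X) x) ->
  exists U, [/\ {subset U <= undup X}, uniq U, forall x, cone U x &
                {in U, forall u, ~ cone (rem u U) u}].
  case=> [||U [UX uU Ufull Umin]]; first exact: undup_uniq.
    by move=> x; apply: cone_sub (Xfull x) => y; rewrite mem_undup.
  by exists U; split=> // u /UX; rewrite mem_undup.
move: (undup X) => {Xfull}{}X.
move: {2}(size X) (leqnn (size X)) => m; elim: m X => [|m IH] X.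
  by case: X => // _ uX Xfull; exists [::].
move=> sX uX Xfull.
have [[u uX' uC]|nex] := pselect (exists2 u, u \in X & cone (rem u X) u);
  last first.
  by exists X; split=> // u uX' uC; apply: nex; exists u.
have [||x|U [UX uU Ufull Umin]] := IH (rem u X).
- by rewrite size_rem // -ltnS prednK //; case: (X) uX'.
- exact: rem_uniq.
- apply: cone_trans (Xfull x) => w wX; have [->//|wu] := eqVneq w u.
  by apply: cone_mem; rewrite mem_rem_uniq // inE wu.
by exists U; split=> // w /UX/mem_rem.
Qed.

(** Since every coefficient is positive, freeness of the tail makes the relation unique up to
    scaling and the tail a basis of the span. *)
Definition positive_circuit Y : Prop := [/\ Y != [::], uniq Y, free (behead Y) &
  exists2 l : 'rV[R]_n -> R, {in Y, forall y, 0 < l y} &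
    \sum_(y <- Y) l y *: y = 0].

Lemma positive_circuit_neg Y w : positive_circuit Y -> w \in Y -> cone Y (- w).
Proof.
move=> [_ _ _ [l l0 lY]] wY; have lw := l0 w wY.
move/eqP: lY; rewrite (perm_big _ (perm_to_rem wY)) /= big_cons addrC addr_eq0.
move=> /eqP sumE; have -> : - w = (l w)^-1 *: \sum_(y <- rem w Y) l y *: y.
  by rewrite sumE scalerN scalerA mulVf ?gt_eqF // scale1r.
apply: coneZ; first by rewrite invr_ge0 ltW.
apply: cone_sum => y /mem_rem yY; apply: coneZ (cone_mem yY).
exact/ltW/l0.
Qed.

Lemma positive_circuit_span Y :
  positive_circuit Y -> <<behead Y>>%VS = <<Y>>%VS.
Proof.
case: Y => [|y Y] [//= _ _ _ [l l0 lY]].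
have ly := l0 y (mem_head _ _); rewrite span_cons; apply/esym/addv_idPr.
rewrite -memvE; move/eqP: lY; rewrite big_cons addr_eq0 => /eqP yE.
have -> : y = (l y)^-1 *: (l y *: y) by rewrite scalerA mulVf ?gt_eqF ?scale1r.
rewrite yE memvZ // memvN big_seq memv_suml // => z zY.
by rewrite memvZ // memv_span.
Qed.

Lemma positive_circuit_simplex Y : positive_circuit Y -> simplex_rel_int_0 Y.
Proof.
case: Y => [|y Y] [//= _ uY fY [l l0 lY]].
have ly := l0 y (mem_head _ _).
have lsum : 0 < \sum_(z <- y :: Y) l z.
  rewrite big_cons ltr_pwDl // big_seq sumr_ge0 // => z zY.
  by rewrite ltW // l0 // inE zY orbT.
split.
  apply: affine_indep_coef => // c c0 cY.
  (* Subtracting [k] times the positive relation removes [y], so freeness of the tail gives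
     [c = k * l]; the zero sum of [c] then forces [k = 0]. *)
  pose k := c y / l y.
  have ck : {in y :: Y, forall z, c z = k * l z}.
    have : \sum_(z <- y :: Y) (c z - k * l z) *: z = 0.
      under eq_bigr do rewrite scalerBl -scalerA.
      by rewrite sumrB -scaler_sumr cY lY scaler0 subrr.
    rewrite big_cons {1}/k divfK ?gt_eqF // subrr scale0r add0r.
    move=> /(free_coef fY) cE z; rewrite inE => /orP[/eqP->|/cE/eqP].
      by rewrite /k divfK // gt_eqF.
    by rewrite subr_eq0 => /eqP.
  have : k * \sum_(z <- y :: Y) l z == 0.
    apply/eqP; rewrite mulr_sumr -[RHS]c0 !big_seq.
    by apply: eq_bigr => z /ck.
  rewrite mulf_eq0 (gt_eqF lsum) orbF => /eqP k0 z /ck->.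
  by rewrite k0 mul0r.
exists (fun i => l (y :: Y)`_i / \sum_(z <- y :: Y) l z); split.
  by move=> i; rewrite divr_gt0 // l0 // mem_nth.
split.
  rewrite -mulr_suml -(big_mkord xpredT (fun i => l (y :: Y)`_i)).
  by rewrite -(big_nth 0 xpredT) divff // gt_eqF.
under eq_bigr do rewrite mulrC -scalerA.
rewrite -scaler_sumr.
rewrite -(big_mkord xpredT (fun i => l (y :: Y)`_i *: (y :: Y)`_i)).
by rewrite -(big_nth 0 xpredT (fun z => l z *: z)) lY scaler0.
Qed.

End PositiveCircuits.

(** * Growing a family of circuits with independent spans *)

Section Decomposition.
Variables (R : realType) (n : nat) (P : 'rV[R]_n -> Prop) (X U : seq 'rV[R]_n).
Hypotheses (n0 : (0 < n)%N) (Ppoly : polytope P) (Pfull : full_dim P).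
Hypothesis Psm : strongly_monotypic P.
Hypothesis XP : forall u, u \in X <-> normals P u.
Hypotheses (UX : {subset U <= X}) (uU : uniq U).
Hypotheses (Ufull : forall x, cone U x).
Hypothesis Umin : {in U, forall u, ~ cone (rem u U) u}.
Implicit Types (u v w x y : 'rV[R]_n) (Y T B : seq 'rV[R]_n).
Implicit Types (Xs : seq (seq 'rV[R]_n)).

(* Dropping one vector from a circuit gives a basis of its span, so freeness of
   the remaining vectors says that the spans are independent. *)
Definition circuit_family Xs : Prop :=
  {in Xs, forall Y, positive_circuit Y /\ {subset Y <= U}} /\
  free (flatten (map behead Xs)).

Lemma circuit_family_mem_span Xs x : circuit_family Xs ->
  x \in flatten Xs -> x \in <<flatten (map behead Xs)>>%VS.
Proof.
move=> [XsC _] /flattenP[Y YXs xY]; have [Yc _] := XsC Y YXs.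
have : x \in <<behead Y>>%VS by rewrite positive_circuit_span // memv_span.
apply/subvP/sub_span => y yY; apply/flattenP; exists (behead Y) => //.
exact: map_f.
Qed.

(** The cone of a positive circuit contains the negatives of its elements, hence its whole span. *)
Lemma circuit_family_cone Xs x : circuit_family Xs ->
  x \in <<flatten (map behead Xs)>>%VS -> cone (flatten Xs) x.
Proof.
move=> [XsC _]; apply: span_cone => b.
move=> /flattenP[_ /mapP[Y YXs ->]] /mem_behead bY.
have [Yc _] := XsC Y YXs.
have sub : {subset Y <= flatten Xs} by move=> y yY; apply/flattenP; exists Y.
split; first exact/cone_mem/sub.
exact: cone_sub sub (positive_circuit_neg Yc bY).
Qed.

Lemma circuit_family_sub Xs : circuit_family Xs -> {subset flatten Xs <= U}.
Proof. by move=> [XsC _] x /flattenP[Y /XsC[_ YU] /YU]. Qed.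

(** Writing [- y] as [t *: y] plus a combination of the other vectors and solving for [y] divides by
    [1 + t > 0]. *)
Lemma cone_rem_neg y : y \in U -> cone (rem y U) (- y).
Proof.
move=> yU; have [t t0] : cone (y :: rem y U) (- y).
  by apply: cone_sub (Ufull (- y)) => z; rewrite (perm_mem (perm_to_rem yU)).
rewrite -[in X in X -> _]scaleN1r -scalerBl => tC.
have t1 : 0 < 1 + t by rewrite ltr_pwDl.
have -> : - y = (1 + t)^-1 *: ((-1 - t) *: y).
  by rewrite scalerA -opprD mulrN mulVf ?gt_eqF // scaleN1r.
by apply: coneZ tC; rewrite invr_ge0 ltW.
Qed.

Lemma relation_zero Xs y Y (l : 'rV[R]_n -> R) : circuit_family Xs ->
  y \in U -> y \notin <<flatten (map behead Xs)>>%VS ->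
  {subset Y <= rem y U} -> free (Y ++ flatten (map behead Xs)) ->
  {in Y, forall z, 0 < l z} ->
  y + \sum_(z <- Y) l z *: z \in <<flatten (map behead Xs)>>%VS ->
  y + \sum_(z <- Y) l z *: z = 0.
Proof.
set B := flatten _; set r := y + _ => XsF yU yB YU fYB l0 rB.
apply: contrapT => /eqP r0.
have [|c c0 rE] := @cone_coef _ _ (undup (flatten Xs)) r (undup_uniq _).
  apply: cone_sub (circuit_family_cone XsF rB) => z; by rewrite mem_undup.
(* With the empty [B] this is the usual Caratheodory theorem, yielding an independent [T]. *)
have [|T [d [TV fT d0]]] := @caratheodory_mod _ _ [::] (undup (flatten Xs)) r c
    (nil_free _) (undup_uniq _) (fun s _ => c0 s).
  by rewrite -rE subrr mem0v.
rewrite cats0 in fT; rewrite span_nil memv0 subr_eq0 => /eqP rT.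
have TXs : {subset T <= flatten Xs} by move=> t /TV; rewrite mem_undup.
have TB : {subset T <= <<B>>%VS}.
  by move=> t /TXs; apply: circuit_family_mem_span.
have fYT : free (Y ++ T).
  move: fYB; rewrite !cat_free fT => /and3P[-> _ /directv_addP YB] /=.
  apply/directv_addP/eqP; rewrite -subv0 -YB capvS //.
  exact/span_subvP.
have yY : y \notin Y by apply/negP => /YU; rewrite mem_rem_uniqF.
have yT : y \notin T by apply: contra yB => /TB.
have uC : uniq (y :: Y ++ T).
  by rewrite /= mem_cat negb_or yY yT free_uniq.
have YT z : z \in Y -> z \notin T.
  move: (free_uniq fYT); rewrite cat_uniq => /and3P[_ /hasPn TY _] zY.
  by apply: contraL zY => /TY.
have CU : {subset y :: Y ++ T <= U}.
  move=> z; rewrite inE mem_cat => /or3P[/eqP->//|/YU/mem_rem//|/TXs].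
  exact: circuit_family_sub.
(* The coefficients of the relation equating the two expressions of [r]. [sumC] takes values in any
   module, to serve both for vectors and for prescribed dot products. *)
pose e c := if c \in T then - d c else if c == y then 1 else l c.
have sumC (V : lmodType R) (g : 'rV[R]_n -> V) :
  \sum_(c <- y :: Y ++ T) e c *: g c =
  g y + \sum_(z <- Y) l z *: g z - \sum_(t <- T) d t *: g t.
  rewrite big_cons big_cat /= {1}/e (negPf yT) eqxx scale1r addrA.
  congr (_ + _ + _).
    rewrite !big_seq; apply: eq_bigr => z zY; rewrite /e (negPf (YT z zY)).
    by case: eqP => // zy; rewrite zy (negPf yY) in zY.
  rewrite -sumrN !big_seq; apply: eq_bigr => t tT.
  by rewrite /e tT scaleNr.
have eC : \sum_(c <- y :: Y ++ T) e c *: c = 0 by rewrite sumC -rT subrr.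
have [y1 y1Y] : exists y1, y1 \in Y.
  have : Y != [::].
    by apply: contraNneq yB => Y0; move: rB; rewrite /r Y0 big_nil addr0.
  by case: (Y) => // y1 Y' _; exists y1; rewrite mem_head.
have [t tT] : exists t, t \in T.
  case: (T) rT => [|t T' _]; last by exists t; rewrite mem_head.
  by move=> rT; rewrite rT big_nil eqxx in r0.
have [[t1 t1T t1t]|nex] := pselect (exists2 t1, t1 \in T & t1 != t).
  apply: (strongly_monotypic_circuit n0 Ppoly Pfull XP (a0 := y) (a1 := y1)
           (b0 := t) (b1 := t1) Psm uC _ eC).
  - by move=> z /CU /UX.
  (* Values can be prescribed freely on the independent [Y ++ T]; the relation then forces the one
     at [y]. *)
  - move=> f sumf; have [x xE] := free_prescribe f fYT; exists x => b.
    rewrite inE => /orP[/eqP->|]; last exact: xE.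
    have := sumC R^o f; rewrite [LHS]sumf => /esym/eqP.
    rewrite subr_eq0 => /eqP fE; apply: (addIr (\sum_(z <- Y) l z * f z)).
    rewrite [RHS]fE; transitivity (dot r x).
      rewrite /r dotDl dot_suml !big_seq; congr (_ + _); apply: eq_bigr => z zY.
      by rewrite dotZl xE // mem_cat zY.
    rewrite rT dot_suml !big_seq; apply: eq_bigr => z zT.
    by rewrite dotZl xE // mem_cat zT orbT.
  - by rewrite mem_head.
  - by rewrite inE mem_cat y1Y orbT.
  - by apply: contraNneq yY => ->.
  - by rewrite /e (negPf yT) eqxx ltr01.
  - rewrite /e (negPf (YT _ y1Y)); case: eqP => // _.
    exact: l0.
  - by rewrite inE mem_cat tT !orbT.
  - by rewrite inE mem_cat t1T !orbT.
  - by rewrite eq_sym.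
  - by rewrite /e tT oppr_lt0 d0.
  - by rewrite /e t1T oppr_lt0 d0.
(* Now [T] is reduced to [t], so [t] is a positive multiple of [r], a combination of [y :: Y] inside
   [rem t U]. *)
have tU : t \in U by apply: circuit_family_sub XsF _ (TXs _ tT).
have rE' : r = d t *: t.
  rewrite rT (bigD1_seq t) ?free_uniq //= big_seq_cond big_pred0 ?addr0 // => z.
  by apply/negP => /andP[zT zt]; apply: nex; exists z.
apply: (Umin tU); have dt := d0 _ tT.
suff /(coneZ (a := (d t)^-1)) : cone (rem t U) r.
  by rewrite rE' scalerA mulVf ?gt_eqF // scale1r invr_ge0; apply; apply: ltW.
have mem_remt z : z \in y :: Y -> cone (rem t U) z.
  move=> zY; apply: cone_mem; rewrite mem_rem_uniq // inE CU; last first.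
    by move: zY; rewrite !inE mem_cat => /orP[->|->]; rewrite ?orbT.
  rewrite andbT; apply/eqP => zt; move: zY; rewrite inE zt => /orP[/eqP ty|tY].
    by rewrite -ty tT in yT.
  by have := YT t tY; rewrite tT.
apply: coneD; first by apply: mem_remt; rewrite mem_head.
apply: cone_sum => z zY; apply: coneZ; first exact/ltW/l0.
by apply: mem_remt; rewrite inE zY orbT.
Qed.

Lemma circuit_family_grow Xs : circuit_family Xs ->
  <<flatten (map behead Xs)>>%VS != fullv ->
  exists2 Y, behead Y != [::] & circuit_family (Y :: Xs).
Proof.
move=> XsF nfull; set B := flatten _ in nfull *.
have [y yU yB] : exists2 y, y \in U & y \notin <<B>>%VS.
  apply: contrapT => nex; case/negP: nfull; apply/eqP/vspaceP => x.
  rewrite memvf; have : x \in <<U>>%VS by apply: cone_span.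
  apply/subvP/span_subvP => u uU'; apply/negPn/negP => uB.
  by apply: nex; exists u.
have [c c0 yE] := cone_coef (rem_uniq y uU) (cone_rem_neg yU).
have [|Y [l [YU fYB l0 lB]]] := @caratheodory_mod _ _ B (rem y U) (- y) c
   XsF.2 (rem_uniq y uU) (fun s _ => c0 s).
  by rewrite -yE subrr mem0v.
rewrite -opprD memvN in lB.
have r0 := relation_zero XsF yU yB YU fYB l0 lB.
(* With [y] at the head the tail is [Y], so [fYB] is exactly the independence required of the
   enlarged family. *)
exists (y :: Y) => [|/=].
  by apply: contraNneq yB => /= Y0; move: lB; rewrite Y0 big_nil addr0.
have yY : y \notin Y by apply/negP => /YU; rewrite mem_rem_uniqF.
split=> [Z|//]; rewrite inE => /orP[/eqP->|]; last exact: XsF.1.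
have fY := catl_free fYB.
split; last by move=> z; rewrite inE => /orP[/eqP->|/YU/mem_rem].
split; rewrite //= ?yY ?free_uniq //.
exists (fun z => if z == y then 1 else l z) => [z|].
  by rewrite inE; case: eqP => [_ _|_ /=]; [exact: ltr01|exact: l0].
rewrite big_cons eqxx scale1r -[RHS]r0; congr (_ + _); rewrite !big_seq.
by apply: eq_bigr => z zY; case: eqP => // zy; rewrite zy (negPf yY) in zY.
Qed.

Lemma spanning_circuit_family : exists2 Xs, circuit_family Xs &
  <<flatten (map behead Xs)>>%VS = fullv.
Proof.
suff grow m Xs : (n - size (flatten (map behead Xs)) <= m)%N ->
    circuit_family Xs ->
    exists2 Xs, circuit_family Xs & <<flatten (map behead Xs)>>%VS = fullv.
  apply: (grow n [::]) => //=; first exact: leq_subr.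
  by split; rewrite ?nil_free.
elim: m Xs => [|m IH] Xs sXs XsF.
  exists Xs => //; apply/eqP; rewrite eqEdim subvf dim_rV.
  by have /eqP-> := XsF.2; rewrite -subn_eq0 -leqn0.
have [full|nfull] := eqVneq <<flatten (map behead Xs)>>%VS fullv.
  by exists Xs.
have [Y Y0 YXsF] := circuit_family_grow XsF nfull.
apply: IH YXsF; rewrite /= size_cat.
move: Y0 sXs; rewrite -size_eq0; set a := size _; set b := size _.
by move: a b => a b; lia.
Qed.

End Decomposition.

(** * Decomposition of the space by circuits of facet normals *)

Theorem theorem3 (R : realType) (n : nat) (P : 'rV[R]_n -> Prop) :
  (0 < n)%N -> polytope P -> full_dim P -> strongly_monotypic P ->
  exists (k : nat) (X : 'I_k -> seq 'rV[R]_n),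
    (0 < k)%N /\
    (forall i x, x \in X i -> normals P x) /\
    (forall i j, i != j -> forall x, x \in X i -> x \notin X j) /\
    (forall i, simplex_rel_int_0 (X i)) /\
    directv (\sum_(i < k) <<X i>>)%VS /\
    (\sum_(i < k) <<X i>>)%VS = fullv.
Proof.
move=> n0 Ppoly Pfull Psm.
have [X uX XP] := normals_enum n0 Ppoly Pfull.
have [U [UX uU Ufull Umin]] :=
  minimal_cone_spanning (cone_normals Ppoly Pfull XP).
have [Xs XsF Xsfull] :=
  spanning_circuit_family n0 Ppoly Pfull Psm XP UX uU Ufull Umin.
have XsC (i : 'I_(size Xs)) := XsF.1 _ (mem_nth [::] (ltn_ord i)).
have sumE : (\sum_(i < size Xs) <<nth [::] Xs i>>)%VS = fullv.
  apply/eqP; rewrite eqEsubv subvf -Xsfull; apply/span_subvP => x.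
  move=> /flattenP[_ /mapP[Y /(nthP [::])[i iXs <-] ->] /mem_behead xY].
  by apply: (subvP (sumv_sup (Ordinal iXs) _ (subvv _))); rewrite ?memv_span.
(* The dimensions add up: the concatenated tails are a basis of the space and each tail is a basis
   of its span. *)
have direct : directv (\sum_(i < size Xs) <<nth [::] Xs i>>)%VS.
  apply/directvP => /=; rewrite sumE -Xsfull.
  have /eqP-> := XsF.2; rewrite size_flatten /shape -map_comp sumnE big_map.
  rewrite (big_nth [::]) big_mkord; apply: eq_bigr => i _ /=.
  have [Yc _] := XsC i; rewrite -positive_circuit_span //.
  by case: Yc => _ _ /eqP-> _.
exists (size Xs), (fun i => nth [::] Xs i); split.
  rewrite lt0n; apply/eqP => Xs0.
  move: (dim_rV R n); rewrite -Xsfull (size0nil Xs0) /= span_nil dimv0 => n0'.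
  by rewrite -n0' in n0.
split; first by move=> i x xXi; apply/XP/UX; apply: (XsC i).2.
split; last by split=> // i; apply: positive_circuit_simplex; case: (XsC i).
(* A common element would lie in two summands of a direct sum and vanish, but facet normals are unit
   vectors. *)
move=> i j ij x xi; apply/negP => xj.
have x0 : x = 0.
  have /directv_sumP/(_ i isT) cap0 := direct.
  apply/eqP; rewrite -memv0 -cap0 memv_cap memv_span //=.
  apply: (subvP (sumv_sup j _ (subvv _))); first by rewrite eq_sym.
  exact: memv_span.
have [x1 _] : normals P x by apply/XP/UX; apply: (XsC i).2.
by move: (unit_neq0 x1); rewrite x0 eqxx.
Qed.
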